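(* Let $\mathbb{C}$ be a standard Cauchy random variable and define $V_1=\frac{1}{1+\mathbb{C}}$ and $V_{n+1}=\frac{1}{1+V_n}$ for $n\ge1$. For every $n\ge 1$, $V_n$ is Cauchy distributed with scale parameter $a_n$ and location parameter $b_n$ given by $$a_n=\frac{1}{F_{2n+1}},\qquad b_n=\frac{F_{2n}}{F_{2n+1}},$$ where $(F_n)_{n\ge0}$ is the Fibonacci sequence. Moreover the sequences $(a_n)_{n\ge1}$ and $(b_n)_{n\ge1}$ are monotone, with $(b_n)_{n\ge1}$ increasing, and $$\lim_{n\to\infty}a_n=0,\qquad \lim_{n\to\infty}b_n=\phi-1,$$ where $\phi=\frac{1+\sqrt5}{2}$.
   Context: A Cauchy random variable with scale parameter $a>0$ and location parameter $b\in\mathbb{R}$ has density $\frac{1}{\pi}\frac{a}{(x-b)^2+a^2}$, $x\in\mathbb{R}$. It is standard if $a=1$ and $b=0$. The Fibonacci sequence is $F_0=0$, $F_1=1$, $F_{n+2}=F_{n+1}+F_n$. The variables $V_n$ are defined almost surely. *)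

(* Defs.v *)
From mathcomp Require Import all_boot all_order all_algebra.
From mathcomp Require Import all_classical all_reals all_analysis.
Import Order.TTheory GRing.Theory Num.Theory.
Import numFieldNormedType.Exports.

Set Implicit Arguments.
Unset Strict Implicit.
Unset Printing Implicit Defensive.

Local Open Scope classical_set_scope.
Local Open Scope ring_scope.

Fixpoint fib (n : nat) : nat :=
  match n with
  | 0 => 0
  | n1.+1 => if n1 is n2.+1 then fib n1 + fib n2 else 1
  end%N.

Definition cauchy_pdf (R : realType) (a b x : R) : R :=
  pi^-1 * (a / ((x - b) ^+ 2 + a ^+ 2)).

(* The law of X is absolutely continuous with density [cauchy_pdf a b];
   a is the scale and b the location. *)
Definition is_cauchy d (T : measurableType d) (R : realType)
    (P : probability T R) (X : {RV P >-> R}) (a b : R) : Prop :=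
  0 < a /\
  forall A : set R, measurable A ->
    distribution P X A = (\int[lebesgue_measure]_(x in A) (cauchy_pdf a b x)%:E)%E.

Definition monotone_seq (R : realType) (u : nat -> R) : Prop :=
  nondecreasing_seq u \/ nonincreasing_seq u.

Definition scale (R : realType) (n : nat) : R := 1 / (fib (2 * n + 1))%:R.

Definition location (R : realType) (n : nat) : R :=
  (fib (2 * n))%:R / (fib (2 * n + 1))%:R.

Definition golden_ratio (R : realType) : R := (1 + Num.sqrt 5) / 2.

(* Main.v *)
Require Import Defs.
From HB Require Import structures.
From mathcomp Require Import all_boot all_order all_algebra.
From mathcomp Require Import all_classical all_reals all_analysis.
From mathcomp Require Import measurable_realfun.
From mathcomp Require Import ring lra zify.
Import Order.TTheory GRing.Theory Num.Theory.
Import numFieldNormedType.Exports.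
Set Implicit Arguments.
Unset Strict Implicit.
Unset Printing Implicit Defensive.

Local Open Scope classical_set_scope.
Local Open Scope ring_scope.

(** If X is Cauchy with parameters (a, b), then 1 / (1 + X) is Cauchy with
    parameters (a / s, (1 + b) / s) where s = a^2 + (1 + b)^2: substitute
    v = 1 / u - 1 in the integral of the density over the closed intervals that
    avoid 0. Together with {0}, which is null for both laws, these intervals form
    a pi-system generating the Borel sets, with a countable cover.  By Cassini's
    identity the parameters 1 / F_{2n+1}, F_{2n} / F_{2n+1} obey this recursion,
    starting from (1, 0) at n = 0.  The limit of b_n comes from
    F_k + psi F_{k+1} = psi^{k+1} for psi = 1 - phi, where |psi| <= 1. *)

(** * Fibonacci identities *)

(** Cassini's identity at an even index, with $F_{2n+2}$ expanded and no subtraction, so that it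
    makes sense in [nat]. *)
Lemma fib_cassini (n : nat) :
  (fib (2 * n + 1) ^ 2 = fib (2 * n) ^ 2 + fib (2 * n) * fib (2 * n + 1) + 1)%N.
Proof.
elim: n => [//|n].
rewrite (_ : 2 * n.+1 = (2 * n).+2)%N ?addn1; last lia.
move=> /=.
case: (2 * n)%N => [//|k] /=; move: (fib k) (fib k.+1) => u v; nia.
Qed.

Lemma fib2S (n : nat) :
  (fib (2 * n.+1) = fib (2 * n) + fib (2 * n + 1))%N /\
  (fib (2 * n.+1 + 1) = fib (2 * n) + 2 * fib (2 * n + 1))%N.
Proof.
rewrite (_ : 2 * n.+1 = (2 * n).+2)%N ?addn1; last lia.
by rewrite -[fib (2 * n).+3]/(fib (2 * n).+2 + fib (2 * n).+1)%N
  -[fib (2 * n).+2]/(fib (2 * n).+1 + fib (2 * n))%N; split; lia.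
Qed.

(** * The Cauchy density and its measure *)

Lemma cauchy_pdf_gt0 (R : realType) (a b x : R) : 0 < a -> 0 < cauchy_pdf a b x.
Proof.
move=> a0; rewrite mulr_gt0 ?invr_gt0 ?pi_gt0// divr_gt0//.
by rewrite ltr_wpDl ?sqr_ge0 ?exprn_gt0.
Qed.

Lemma continuous_cauchy_pdf (R : realType) (a b : R) :
  0 < a -> continuous (cauchy_pdf a b).
Proof.
move=> a0 x; apply: cvgM; first exact: cvg_cst.
apply: cvgM; first exact: cvg_cst.
apply: cvgV; first by rewrite gt_eqF// ltr_wpDl ?sqr_ge0 ?exprn_gt0.
apply: cvgD; last exact: cvg_cst.
by apply: cvgM; (apply: cvgB; [exact: cvg_id|exact: cvg_cst]).
Qed.

(* The positivity proof is a parameter so that the measure instance below can be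
   inferred. *)
Definition cauchy_measure (R : realType) (a b : R) (a0 : 0 < a) (A : set R) :
    \bar R :=
  (\int[lebesgue_measure]_(x in A) (cauchy_pdf a b x)%:E)%E.

Lemma cauchy_measure0 (R : realType) (a b : R) (a0 : 0 < a) :
  cauchy_measure b a0 set0 = 0%E.
Proof. exact: integral_set0. Qed.

Lemma cauchy_measure_ge0 (R : realType) (a b : R) (a0 : 0 < a) (A : set R) :
  (0 <= cauchy_measure b a0 A)%E.
Proof. by apply: integral_ge0 => x _; rewrite lee_fin ltW// cauchy_pdf_gt0. Qed.

Lemma cauchy_measure_semi_sigma_additive (R : realType) (a b : R) (a0 : 0 < a) :
  semi_sigma_additive (cauchy_measure b a0).
Proof.
have := @semi_sigma_additive_nng_induced _ _ R lebesgue_measure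
  (fun x => (cauchy_pdf a b x)%:E); apply.
  apply/measurable_EFinP; apply: continuous_measurable_fun.
  exact: continuous_cauchy_pdf.
by move=> x; rewrite lee_fin ltW// cauchy_pdf_gt0.
Qed.

HB.instance Definition _ (R : realType) (a b : R) (a0 : 0 < a) :=
  isMeasure.Build _ _ _ (cauchy_measure b a0) (cauchy_measure0 b a0)
    (cauchy_measure_ge0 b a0) (@cauchy_measure_semi_sigma_additive R a b a0).

(** * The substitution $v = 1/u - 1$ *)

(** With $s = a^2 + (1+b)^2$, completing the square gives $u^2((1/u - 1 - b)^2 + a^2) = su^2 -
    2(1+b)u + 1 = s((u - (1+b)/s)^2 + (a/s)^2)$. *)
Lemma cauchy_pdf_reciprocal (R : realType) (a b u : R) : 0 < a -> u != 0 ->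
  cauchy_pdf a b (u^-1 - 1) * u ^- 2 =
  cauchy_pdf (a / (a ^+ 2 + (1 + b) ^+ 2)) ((1 + b) / (a ^+ 2 + (1 + b) ^+ 2)) u.
Proof.
move=> a0 u0; rewrite /cauchy_pdf -!mulrA; congr (_ * _).
have s0 : a ^+ 2 + (1 + b) ^+ 2 != 0.
  by rewrite gt_eqF// ltr_wpDr ?sqr_ge0 ?exprn_gt0.
have aneq : a != 0 by rewrite gt_eqF.
field; rewrite s0 u0 /= !gt_eqF// ltr_wpDl ?sqr_ge0// exprn_even_gt0//=.
by rewrite mulf_neq0.
Qed.

Lemma is_derive_reciprocal (R : realType) (u : R) : u != 0 ->
  is_derive u 1 (fun v : R => v^-1 - 1) (- u ^- 2).
Proof.
move=> u0; apply: is_derive_eq.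
  apply: is_deriveB; apply: is_deriveV => //.
by rewrite subr0 /GRing.scale/= mulr1.
Qed.

Lemma near_neq0 (R : realType) (u : R) : u != 0 -> \forall v \near u, v != 0.
Proof.
move=> u0; apply: open_nbhs_nbhs; split=> //; exact: open_neq.
Qed.

(** The formula $-v^{-2}$ for the derivative holds off 0, hence near [u], and continuity at [u]
    transfers along this local equality. *)
Lemma continuous_derive1_reciprocal (R : realType) (u : R) : u != 0 ->
  {for u, continuous (derive1 (fun v : R => v^-1 - 1))}.
Proof.
move=> u0.
have E (v : R) : v != 0 -> - v ^- 2 = derive1 (fun v : R => v^-1 - 1) v.
  by move=> v0; rewrite derive1E (@derive_val _ _ _ _ _ _ _ (is_derive_reciprocal v0)).
rewrite /prop_for /continuous_at -E//.
have C : (- v ^- 2 : R^o) @[v --> u] --> - u ^- 2.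
  apply: cvgN; apply: cvgV; first by rewrite expf_neq0.
  exact: exprn_continuous.
apply: cvg_trans C; apply: near_eq_cvg.
by near=> v; rewrite E//; near: v; exact: near_neq0.
Unshelve. all: by end_near. Qed.

Lemma integral_cauchy_pdf_reciprocal (R : realType) (a b x y : R) :
  0 < a -> x <= y -> 0 < x \/ y < 0 ->
  (\int[lebesgue_measure]_(u in `[(y^-1 - 1)%R, (x^-1 - 1)%R]) (cauchy_pdf a b u)%:E =
   \int[lebesgue_measure]_(u in `[x, y])
     (cauchy_pdf (a / (a ^+ 2 + (1 + b) ^+ 2))%R
                 ((1 + b) / (a ^+ 2 + (1 + b) ^+ 2))%R u)%:E)%E.
Proof.
move=> a0 xy xy0.
have n0 u : u \in `[x, y] -> u != 0.
  rewrite in_itv/= => /andP[xu uy]; apply/eqP => u0; case: xy0; lra.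
have xI : x \in `[x, y] by rewrite in_itv/= lexx.
have yI : y \in `[x, y] by rewrite in_itv/= lexx andbT.
have dF u : u \in `[x, y] -> derivable (fun v : R => v^-1 - 1) u 1.
  by move=> /n0 u0; have [] := is_derive_reciprocal u0.
have cF u : u \in `[x, y] -> {for u, continuous (fun v : R => v^-1 - 1)}.
  by move=> /dF /derivable1_diffP /differentiable_continuous.
have cF' u : u \in `[x, y] -> {for u, continuous (derive1 (fun v : R => v^-1 - 1))}.
  by move=> /n0 /continuous_derive1_reciprocal.
rewrite (@integration_by_substitution_decreasing R (fun v => v^-1 - 1)) //.
- apply: eq_integral => u; rewrite inE/= => /n0 u0; congr EFin.
  rewrite -cauchy_pdf_reciprocal// fctE/=; congr (_ * _).
  by rewrite fctE derive1E (@derive_val _ _ _ _ _ _ _ (is_derive_reciprocal u0)) opprK.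
- move=> u v uI vI vu; rewrite ltrD2r.
  have: v^-1 - u^-1 = (u - v) / (u * v).
    by field; rewrite !n0.
  (* Both points lie on the same side of 0, which makes the reciprocal decreasing between them. *)
  have uv0 : 0 < u * v.
    move: uI vI; rewrite !in_itv/= => /andP[xu uy] /andP[xv vy].
    case: xy0 => ?; [rewrite mulr_gt0//; lra|rewrite nmulr_rgt0; lra].
  by move=> uvE; rewrite -subr_gt0 uvE divr_gt0// subr_gt0.
- by move=> u /subset_itv_oo_cc; exact: cF'.
- apply/cvg_ex; exists (derive1 (fun v : R => v^-1 - 1) x).
  exact/cvg_at_right_filter/cF'.
- apply/cvg_ex; exists (derive1 (fun v : R => v^-1 - 1) y).
  exact/cvg_at_left_filter/cF'.
- split.
  + by move=> u /subset_itv_oo_cc; exact: dF.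
  + exact/cvg_at_right_filter/cF.
  + exact/cvg_at_left_filter/cF.
- exact/continuous_subspaceT/continuous_cauchy_pdf.
Qed.

Lemma invr_itv_pos (R : realFieldType) (x y t : R) : 0 < x -> x <= y ->
  (t^-1 \in `[x, y]) = (t \in `[y^-1, x^-1]).
Proof.
move=> x0 xy; have y0 : 0 < y by apply: lt_le_trans xy.
rewrite !in_itv/=; have [t0|t0] := ltP 0 t.
  by rewrite (invf_ple t0 y0) -(invf_pge x0 t0) andbC.
(* For $t \le 0$ both memberships fail; [t = 0] is included because [0^-1 = 0]. *)
have -> : (x <= t^-1) = false.
  by apply/negbTE; rewrite -ltNge (le_lt_trans _ x0)// invr_le0.
by rewrite andFb leNgt (le_lt_trans t0) ?invr_gt0.
Qed.

(** The negative case is the positive one reflected through 0. *)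
Lemma invr_itv (R : realFieldType) (x y t : R) : 0 < x \/ y < 0 -> x <= y ->
  (t^-1 \in `[x, y]) = (t \in `[y^-1, x^-1]).
Proof.
case=> [|y0 xy]; first exact: invr_itv_pos.
have := @invr_itv_pos _ (- y) (- x) (- t).
rewrite oppr_gt0 lerN2 => /(_ y0 xy).
by rewrite !invrN !in_itv/= !lerN2 andbC => ->; rewrite andbC.
Qed.

(** * A pi-system generating the Borel sets *)

(** The condition admits [y < x], that is the empty set, for stability under intersection, and {0},
    so that the family can cover the line. *)
Definition itv_cc_avoiding0 (R : realType) : set (set R) :=
  [set A | exists x y : R, A = `[x, y]%classic /\ (x <= 0 -> 0 <= y -> x = 0 /\ y = 0)].

Lemma itv_cc_avoiding0_setI (R : realType) : setI_closed (@itv_cc_avoiding0 R).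
Proof.
move=> _ _ [x [y [-> xy0]]] [x' [y' [-> xy0']]].
exists (Num.max x x'), (Num.min y y'); split.
  apply/seteqP; split=> z /=; rewrite !in_itv/= ge_max le_min.
    by move=> [/andP[-> ->] /andP[-> ->]].
  by move=> /andP[/andP[-> ->] /andP[-> ->]].
rewrite ge_max le_min => /andP[x0 x'0] /andP[y0 y'0].
have [-> ->] := xy0 x0 y0; have [-> ->] := xy0' x'0 y'0.
by rewrite maxxx minxx.
Qed.

(* At [n = 0] this is the singleton {0}, since [0^-1 = 0]. *)
Definition itv_cc_cover (R : realType) (n : nat) : set R :=
  if odd n then `[n%:R^-1, n%:R]%classic else `[- n%:R, - n%:R^-1]%classic.

Lemma itv_cc_coverP (R : realType) (n : nat) : itv_cc_avoiding0 (@itv_cc_cover R n).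
Proof.
rewrite /itv_cc_cover; case: ifPn => on.
  exists n%:R^-1, n%:R; split=> //.
  by rewrite leNgt invr_gt0 ltr0n odd_gt0.
exists (- n%:R), (- n%:R^-1); split=> // _.
by rewrite oppr_ge0 invr_le0 lern0 => /eqP ->; rewrite invr0 oppr0.
Qed.

Lemma bigcup_itv_cc_cover (R : realType) : \bigcup_n @itv_cc_cover R n = setT.
Proof.
have bound (z : R) : 0 < z -> exists N, forall n, (N < n)%N ->
    n%:R^-1 <= z /\ z <= n%:R.
  (* Any [n] beyond this bound exceeds both [z] and [z^-1]. *)
  move=> z0; exists (Num.truncn (z + z^-1)) => n Nn.
  have zn : z + z^-1 < n%:R by rewrite (lt_le_trans (truncnS_gt _))// ler_nat.
  have zV0 : 0 < z^-1 by rewrite invr_gt0.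
  have n0 : 0 < n%:R :> R by rewrite ltr0n (leq_ltn_trans _ Nn).
  by split; [rewrite invf_ple//|]; lra.
apply/seteqP; split=> // z _; have [z0|z0|->] := ltgtP z 0.
- have /bound[N NP] : 0 < - z by rewrite oppr_gt0.
  exists N.+1.*2 => //; rewrite /itv_cc_cover odd_double/= in_itv/=.
  by have [] := NP N.+1.*2 ltac:(lia) => ? ?; apply/andP; split; lra.
- have [N NP] := bound _ z0.
  exists N.*2.+1 => //; rewrite /itv_cc_cover /= odd_double/= in_itv/=.
  by have [-> ->] := NP N.*2.+1 ltac:(lia).
- by exists 0%N => //; rewrite /itv_cc_cover/= in_itv/= invr0 oppr0 lexx.
Qed.

(** The rays $[r, +\infty)$ generate the Borel sets, and each is the countable union of its traces
    on the cover, which stay in the family. *)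
Lemma measurable_itv_cc_avoiding0 (R : realType) (A : set R) :
  measurable A -> <<s @itv_cc_avoiding0 R >> A.
Proof.
have sG : sigma_algebra setT <<s @itv_cc_avoiding0 R >>.
  exact: smallest_sigma_algebra.
rewrite -[measurable A]/((@ocitv R).-sigma.-measurable A).
rewrite RGenCInfty.measurableE.
apply: smallest_sub => // _ [r ->].
have -> : `[r, +oo[%classic = \bigcup_n (`[r, +oo[%classic `&` @itv_cc_cover R n).
  by rewrite -setI_bigcupr bigcup_itv_cc_cover setIT.
case: sG => _ _; apply => n.
have [x [y [-> xy0]]] := @itv_cc_coverP R n.
apply: sub_sigma_algebra; exists (Num.max r x), y; split.
  apply/seteqP; split=> z /=; rewrite !in_itv/= andbT ge_max.
    by move=> [-> /andP[-> ->]].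
  by move=> /andP[/andP[-> ->] ->].
rewrite ge_max => /andP[r0 x0] y0; have [-> ->] := xy0 x0 y0.
by split=> //; apply/max_idPr.
Qed.

Lemma eq_measure_itv_cc_avoiding0 (R : realType)
    (m1 m2 : {measure set R -> \bar R}) :
  (forall A, itv_cc_avoiding0 A -> m1 A = m2 A) ->
  (m1 setT < +oo)%E ->
  forall A, measurable A -> m1 A = m2 A.
Proof.
move=> m12 m1oo A mA.
have Gm : @itv_cc_avoiding0 R `<=` measurable.
  by move=> _ [x [y [-> _]]]; exact: measurable_itv.
apply: (g_sigma_algebra_measure_unique (@itv_cc_avoiding0 R) Gm
  (@itv_cc_cover R)) => //.
- exact: itv_cc_coverP.
- exact: bigcup_itv_cc_cover.
- exact: itv_cc_avoiding0_setI.
- move=> n; apply: le_lt_trans m1oo; apply: le_measure => //; rewrite inE //.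
  exact: Gm (itv_cc_coverP _ _).
- exact: measurable_itv_cc_avoiding0.
Qed.

(** * The law of $1/(1+X)$ *)

(** [A] lies in [B] enlarged by a null set. Used in both directions, this equates the probabilities
    of almost surely equal events. *)
Lemma le_measure_ae d (T : measurableType d) (R : realType)
    (mu : {measure set T -> \bar R}) (A B : set T) :
  measurable A -> measurable B -> {ae mu, forall w, A w -> B w} ->
  (mu A <= mu B)%E.
Proof.
move=> mA mB [N [mN N0 AB]]; rewrite -(measureU0 mB mN N0).
apply: le_measure; rewrite ?inE//; first exact: measurableU.
move=> w Aw; have [Bw|nBw] := pselect (B w); first by left.
by right; apply: AB => /= /(_ Aw).
Qed.

(** A law with a density has no atoms; [c = -1] shows that the denominator $1+X$ is almost surely
    nonzero. *)
Lemma is_cauchy_neq d (T : measurableType d) (R : realType)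
    (P : probability T R) (X : {RV P >-> R}) (a b c : R) :
  is_cauchy X a b -> {ae P, forall w, X w != c}.
Proof.
move=> [a0 XP]; exists (X @^-1` [set c]); split.
- by rewrite -[X @^-1` _]setTI; exact: measurable_funP.
- have := XP [set c] (measurable_set1 c).
  by rewrite integral_set1.
- by move=> w /= /negP; rewrite negbK => /eqP.
Qed.

Lemma is_cauchy_reciprocal d (T : measurableType d) (R : realType)
    (P : probability T R) (X Y : {RV P >-> R}) (a b : R) :
  is_cauchy X a b ->
  {ae P, forall w, 1 + X w != 0 -> Y w = 1 / (1 + X w)} ->
  is_cauchy Y (a / (a ^+ 2 + (1 + b) ^+ 2)) ((1 + b) / (a ^+ 2 + (1 + b) ^+ 2)).
Proof.
move=> Xab YX; have [a0 XP] := Xab.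
have s0 : 0 < a ^+ 2 + (1 + b) ^+ 2 by rewrite ltr_wpDr ?sqr_ge0 ?exprn_gt0.
have a'0 : 0 < a / (a ^+ 2 + (1 + b) ^+ 2) by rewrite divr_gt0.
have YV : {ae P, forall w, 1 + X w != 0 /\ Y w = (1 + X w)^-1}.
  have := is_cauchy_neq (-1) Xab; apply: filterS2 YX => w /= + X1.
  have X10 : 1 + X w != 0 by rewrite addrC -(opprK 1) subr_eq0.
  by rewrite div1r => /(_ X10).
split=> // A mA.
pose m2 := cauchy_measure ((1 + b) / (a ^+ 2 + (1 + b) ^+ 2)) a'0.
rewrite -[RHS]/(m2 A).
apply: eq_measure_itv_cc_avoiding0 mA => /=; last first.
  by rewrite probability_setT ltry.
move=> _ [x [y [-> xy0]]].
have mY (B : set R) : measurable B -> measurable (Y @^-1` B).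
  by move=> mB; rewrite -[_ @^-1` _]setTI; exact: measurable_funP.
have mX (B : set R) : measurable B -> measurable (X @^-1` B).
  by move=> mB; rewrite -[_ @^-1` _]setTI; exact: measurable_funP.
rewrite /m2 /cauchy_measure /distribution /pushforward.
have [xy|yx] := leP x y; last first.
  by rewrite set_itv_ge ?bnd_simp -?ltNge// preimage_set0 measure0 integral_set0.
have [[x0 y0]|xy'] : (x <= 0 /\ 0 <= y) \/ (0 < x \/ y < 0) by lra.
  have [-> ->] := xy0 x0 y0; rewrite set_itv1 integral_set1.
  (* The case of {0}: [Y w = 0] would force [1 + X w = 0], which is almost surely excluded. *)
  apply/negligibleP; first exact: mY.
  apply: negligibleS YV => w /= Yw [X10 YE].
  by move: X10; rewrite -invr_eq0 -YE Yw eqxx.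
(* The substitution turns the target integral into the probability that [X] lies in
   $[1/y - 1, 1/x - 1]$, leaving two events under [P] to compare. *)
rewrite -integral_cauchy_pdf_reciprocal// -XP; last exact: measurable_itv.
have mem w : 1 + X w != 0 -> Y w = (1 + X w)^-1 ->
    (Y w \in `[x, y]) = (X w \in `[y^-1 - 1, x^-1 - 1]).
  move=> X10 ->; rewrite invr_itv// !in_itv/=.
  by rewrite lerBlDl lerBrDl.
rewrite /distribution /pushforward.
apply/eqP; rewrite eq_le; apply/andP; split.
- apply: le_measure_ae; [exact: mY|exact: mX|].
  by move: YV; apply: filterS => w [X10 YE] /=; rewrite mem.
- apply: le_measure_ae; [exact: mX|exact: mY|].
  by move: YV; apply: filterS => w [X10 YE] /=; rewrite mem.
Qed.

(** * Recursion and monotonicity of the parameters *)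

Lemma fib_odd_gt0 (n : nat) : (0 < fib (2 * n + 1))%N.
Proof. by elim: n => [//|n IH]; have [_ ->] := fib2S n; lia. Qed.

Lemma scaleS_locationS (R : realType) (n : nat) :
  let a := scale R n in let b := location R n in
  scale R n.+1 = a / (a ^+ 2 + (1 + b) ^+ 2) /\
  location R n.+1 = (1 + b) / (a ^+ 2 + (1 + b) ^+ 2).
Proof.
rewrite /scale /location; have [-> ->] := fib2S n.
have := fib_cassini n; have := fib_odd_gt0 n.
move: (fib (2 * n)) (fib (2 * n + 1)) => x y y0 /(congr1 (fun k => k%:R : R)).
rewrite !natrD !natrX !natrM => yE.
have {}y0 : 0 < y%:R :> R by rewrite ltr0n.
have x0 : 0 <= x%:R :> R by [].
move: (x%:R : R) (y%:R : R) yE y0 x0 => {}x {}y yE y0 x0.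
(* So $s = F_{2n+3}/F_{2n+1}$; Cassini enters as $1 + (x+y)^2 = y(x+2y)$. *)
have -> : (1 / y) ^+ 2 + (1 + x / y) ^+ 2 = (x + 2 * y) / y.
  have -> : x + 2 * y = (1 + (x + y) ^+ 2) / y.
    apply/eqP; rewrite eq_sym; rewrite -subr_eq0; apply/eqP.
    have y1 : y != 0 by rewrite gt_eqF.
    have -> : (1 + (x + y) ^+ 2) / y - (x + 2 * y) =
        (x ^+ 2 + x * y + 1 - y ^+ 2) / y by field.
    by rewrite yE subrr mul0r.
  by field; rewrite gt_eqF.
by split; field; rewrite !gt_eqF//; lra.
Qed.

(** After cross-multiplication the inequality reads $x^2 + xy < y^2$, and Cassini makes the gap
    exactly 1. *)
Lemma location_ltS (R : realType) (n : nat) : location R n < location R n.+1.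
Proof.
rewrite /location; have [-> ->] := fib2S n.
have := fib_cassini n; have := fib_odd_gt0 n.
move: (fib (2 * n)) (fib (2 * n + 1)) => x y y0 yE.
rewrite ltr_pdivrMr ?ltr0n// mulrAC ltr_pdivlMr ?ltr0n; last lia.
by rewrite -!natrM ltr_nat; nia.
Qed.

Lemma scale_leS (R : realType) (n : nat) : scale R n.+1 <= scale R n.
Proof.
rewrite /scale; have [_ ->] := fib2S n; have := fib_odd_gt0 n => y0.
by rewrite !div1r lef_pV2 ?posrE ?ltr0n ?ler_nat; lia.
Qed.

(** * Limits of the parameters *)

(** This crude growth suffices to bound [scale] by the harmonic sequence $1/(n+1)$. *)
Lemma fib_odd_ge (n : nat) : (n < fib (2 * n + 1))%N.
Proof. by elim: n => [//|n IH]; have [_ ->] := fib2S n; lia. Qed.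

Lemma cvg_scale (R : realType) : scale R n @[n --> \oo] --> (0 : R).
Proof.
apply: (@squeeze_cvgr _ _ _ _ (cst 0) (@harmonic R)).
- near=> n; rewrite /scale div1r invr_ge0 ler0n /=.
  rewrite lef_pV2 ?posrE ?ltr0n ?fib_odd_gt0// ler_nat.
  exact: fib_odd_ge.
- exact: cvg_cst.
- exact: cvg_harmonic.
Unshelve. all: by end_near. Qed.

Lemma fib_conjugate (R : comNzRingType) (psi : R) (n : nat) :
  psi ^+ 2 = psi + 1 -> (fib n)%:R + psi * (fib n.+1)%:R = psi ^+ n.+1.
Proof.
move=> psi2; elim: n => [|n IH]; first by rewrite mulr1 add0r expr1.
rewrite -[fib n.+2]/(fib n.+1 + fib n)%N natrD exprS -IH.
have -> : psi * ((fib n)%:R + psi * (fib n.+1)%:R) =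
  psi * (fib n)%:R + psi ^+ 2 * (fib n.+1)%:R by ring.
by rewrite psi2; ring.
Qed.

(** Dividing the identity for the conjugate root [psi] by $F_{2n+1}$ gives $b_n + \psi =
    \psi^{2n+1}/F_{2n+1}$, so the error is at most $a_n$. *)
Lemma location_dist (R : realType) (n : nat) :
  `|golden_ratio R - 1 - location R n| <= scale R n.
Proof.
pose psi : R := 1 - golden_ratio R.
have s5 : Num.sqrt (5 : R) ^+ 2 = 5 by rewrite sqr_sqrtr.
have psi2 : psi ^+ 2 = psi + 1 by rewrite /psi /golden_ratio; lra.
have psi1 : `|psi| <= 1.
  have s0 : 0 <= Num.sqrt 5 :> R by rewrite sqrtr_ge0.
  by rewrite ler_norml /psi /golden_ratio; apply/andP; split; nra.
have y0 : 0 < (fib (2 * n + 1))%:R :> R by rewrite ltr0n fib_odd_gt0.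
have E : (fib (2 * n))%:R + psi * (fib (2 * n + 1))%:R = psi ^+ (2 * n + 1).
  by rewrite addn1 fib_conjugate.
have -> : golden_ratio R - 1 - location R n =
    - (psi ^+ (2 * n + 1) / (fib (2 * n + 1))%:R).
  by rewrite -E /location /psi; field; rewrite gt_eqF.
rewrite normrN normf_div (gtr0_norm y0) /scale ler_pM2r ?invr_gt0//.
by rewrite normrX exprn_ile1.
Qed.

Lemma cvg_location (R : realType) :
  location R n @[n --> \oo] --> golden_ratio R - 1.
Proof.
have /cvgr0Pnorm_le S := @cvg_scale R; apply/cvgrPdist_le => e e0.
have := S e e0; apply: filterS => n; apply: le_trans.
exact: le_trans (location_dist R n) (ler_norm _).
Qed.

(* The equations for V are only imposed almost surely, and only where the
   denominator is nonzero, so the values of V elsewhere are irrelevant; V 0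
   is unused. *)
Theorem mainTheorem4 (d : measure_display) (T : measurableType d)
    (R : realType) (P : probability T R)
    (C : {RV P >-> R}) (V : nat -> {RV P >-> R})
    (C_std : is_cauchy C 1 0)
    (V1_def : {ae P, forall w, 1 + C w != 0 -> V 1%N w = 1 / (1 + C w)})
    (VS_def : forall n : nat, (1 <= n)%N ->
       {ae P, forall w, 1 + V n w != 0 -> V n.+1 w = 1 / (1 + V n w)}) :
  [/\ {ae P, forall w, 1 + C w != 0} /\
      (forall n : nat, (1 <= n)%N -> {ae P, forall w, 1 + V n w != 0}),
      forall n : nat, (1 <= n)%N -> is_cauchy (V n) (scale R n) (location R n),
      monotone_seq (fun n => scale R n.+1) /\
      monotone_seq (fun n => location R n.+1),
      increasing_seq (fun n => location R n.+1) &
      scale R n @[n --> \oo] --> (0 : R) /\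
      location R n @[n --> \oo] --> golden_ratio R - 1].
Proof.
have neq (X : {RV P >-> R}) (a b : R) : is_cauchy X a b ->
    {ae P, forall w, 1 + X w != 0}.
  move=> /(is_cauchy_neq (-1)); apply: filterS => w.
  by rewrite -subr_eq0 opprK addrC.
(* As $F_0 = 0$ and $F_1 = 1$, [C] fits the formulas at index 0 and starts the induction. *)
have C0 : is_cauchy C (scale R 0) (location R 0).
  have -> : scale R 0 = 1 by rewrite /scale muln0 add0n divr1.
  have -> : location R 0 = 0 by rewrite /location muln0 mul0r.
  exact: C_std.
have Vn n : is_cauchy (V n.+1) (scale R n.+1) (location R n.+1).
  have [-> ->] := scaleS_locationS R n.
  elim: n => [|n IH]; first exact: is_cauchy_reciprocal C0 V1_def.
  have [E1 E2] := scaleS_locationS R n.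
  rewrite -E1 -E2 in IH.
  by apply: is_cauchy_reciprocal IH _; exact: VS_def.
have incr : increasing_seq (fun n => location R n.+1).
  by apply/increasing_seqP => n; exact: location_ltS.
split=> //.
- by split=> [|[//|n] _]; [exact: neq C_std|exact: neq (Vn n)].
- by case=> [//|n] _; exact: Vn.
- split; [right|left].
    by apply/nonincreasing_seqP => n; exact: scale_leS.
  (* [increasing_seq] is an equivalence between the two orders, so it rewrites the goal to its own
     premise. *)
  by move=> m n; rewrite incr.
- by split; [exact: cvg_scale|exact: cvg_location].
Qed.
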